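(* Let $P$ be a poset. If for each $n\in\mathbb{N}$ the Scott topology on the $n$-fold product poset $\prod^n P$ coincides with the product topology of $n$ copies of $(P,\sigma(P))$, then $\sigma(\Gamma(P))=\upsilon(\Gamma(P))$.
   Context: For a poset $P$, a subset $A\subseteq P$ is Scott closed if it is a lower set and for every directed $D\subseteq A$ whose supremum $\bigvee D$ exists in $P$ one has $\bigvee D\in A$. The Scott topology $\sigma(P)$ consists of the complements of Scott closed sets. $\prod^n P$ carries the coordinatewise order. $\Gamma(P)$ is the complete lattice of all Scott closed subsets of $P$ (including $\emptyset$), ordered by inclusion, and $\sigma(\Gamma(P))$ is the Scott topology of this poset. The lower Vietoris topology $\upsilon(\Gamma(P))$ on $\Gamma(P)$ is generated by the subbase of sets $\Diamond U=\{A\in\Gamma(P): A\cap U\neq\emptyset\}$, $U\in\sigma(P)$. *)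

(* Defs.v *)
From HB Require Import structures.
From mathcomp Require Import all_boot all_order.
From mathcomp Require Import boolp classical_sets functions.
From mathcomp Require Import topology.

Set Implicit Arguments.
Unset Strict Implicit.
Unset Printing Implicit Defensive.

Import Order.TTheory.

Local Open Scope classical_set_scope.
Local Open Scope order_scope.

Section Scott.
Context {d : Order.disp_t} {P : porderType d}.
Implicit Types (A B D U : set P) (x y : P).

Definition lower_set A := forall x y, A y -> x <= y -> A x.

Definition directed D :=
  D !=set0 /\ forall x y, D x -> D y -> exists z, [/\ D z, x <= z & y <= z].

(* Only the directed sets that have a supremum in P are constrained. *)
Definition scott_closed A :=
  lower_set A /\
  forall D s, D `<=` A -> directed D -> isLub D s -> A s.

Definition scott_open U := scott_closed (~` U).

Lemma scott_openT : scott_open setT.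
Proof.
rewrite /scott_open setCT; split=> [x y []|D s D0 [[x Dx] _] _].
exact: D0 Dx.
Qed.

Lemma scott_openI : setI_closed scott_open.
Proof.
move=> U V [lU cU] [lV cV]; rewrite /scott_open setCI; split.
  move=> x y [nU|nV] xy; [left; exact: lU nU xy|right; exact: lV nV xy].
move=> D s DUV [D0 dD] Ds.
have [DU|/existsNP[x /not_implyP[Dx /contrapT Ux]]] := pselect (D `<=` ~` U).
  by left; exact: (cU D).
right; apply: (cV D) => // y Dy Vy.
have [z [Dz xz yz]] := dD _ _ Dx Dy.
by case: (DUV z Dz) => nz; [apply: (lU x z)|apply: (lV y z)].
Qed.

Lemma scott_open_bigcup (I : Type) (f : I -> set P) :
  (forall i, scott_open (f i)) -> scott_open (\bigcup_i f i).
Proof.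
move=> fo; rewrite /scott_open setC_bigcup; split=> [x y nfy xy i _|].
  by have [lf _] := fo i; apply: lf xy; exact: nfy.
move=> D s Df dD Ds i _; have [_ cf] := fo i.
by apply: (cf D) => // x Dx; exact: Df.
Qed.

End Scott.

(* Alias of P carrying the topological space (P, sigma(P)). *)
Definition scott {d : Order.disp_t} (P : porderType d) : Type := P.

HB.instance Definition _ d (P : porderType d) := Order.POrder.on (scott P).
HB.instance Definition _ d (P : porderType d) :=
  isOpenTopological.Build (scott P)
    (@scott_openT d P) (@scott_openI d P) (@scott_open_bigcup d P).

Definition scott_topology {d : Order.disp_t} (P : porderType d) :
    set_system P :=
  @open (scott P).
Arguments scott_topology {d} P _.

Definition scott_product_topology {d : Order.disp_t} (n : nat)
    (P : porderType d) : set_system ('I_n -> P) :=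
  @open {ptws 'I_n -> scott P}.
Arguments scott_product_topology {d} n P _.

(* Gamma(P), with the order induced by the inclusion order on set P. *)
Definition Gamma {d : Order.disp_t} (P : porderType d) : Type :=
  {A : set P | `[< scott_closed A >]}.

HB.instance Definition _ d (P : porderType d) := SubChoice.on (Gamma P).
HB.instance Definition _ d (P : porderType d) :=
  [SubChoice_isSubPOrder of Gamma P by <: with set_display].

Definition diamond {d : Order.disp_t} {P : porderType d} (U : set P) :
    set (Gamma P) :=
  [set A | val A `&` U !=set0].

Definition lower_vietoris {d : Order.disp_t} (P : porderType d) : Type :=
  Gamma P.

HB.instance Definition _ d (P : porderType d) := Choice.on (lower_vietoris P).
HB.instance Definition _ d (P : porderType d) :=
  isSubBaseTopological.Build (lower_vietoris P) (@scott_open d P) diamond.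

Definition lower_vietoris_topology {d : Order.disp_t} (P : porderType d) :
    set_system (Gamma P) :=
  @open (lower_vietoris P).
Arguments lower_vietoris_topology {d} P _.

(* Main.v *)
Require Import Defs.
From mathcomp Require Import all_boot all_order.
From mathcomp Require Import boolp classical_sets functions.
From mathcomp Require Import topology.

(** Inclusion of the lower Vietoris topology in the Scott topology needs no
hypothesis: the complement of [diamond U] consists of the closed sets below
the closed set [~` U], and a principal ideal is always Scott closed.

For the converse, let [UU] be Scott open in [Gamma P] and [A] a member of it.
The closed sets generated by finite tuples of points of [A] form a directed
family whose supremum is [A], so [UU] contains one of them, generated by some
tuple [x] of length [n] ([scott_open_Gamma_fin]).  The map sending an
[n]-tuple to the closed set that it generates is Scott continuous
([scott_open_fin_down]), so the tuples that it sends into [UU] form a Scott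
open set of the [n]-th power of [P].  This is where the hypothesis enters:
that set is open for the product topology, hence contains a box
[U_1 * ... * U_n] around [x].  A closed set meeting every [U_i] contains a
tuple taken from the box, hence lies above a member of [UU] and belongs to
[UU]; so the intersection of the sets [diamond U_i] is a lower Vietoris
neighbourhood of [A] inside [UU]. *)

Set Implicit Arguments.
Unset Strict Implicit.
Unset Printing Implicit Defensive.

Import Order.TTheory.

Local Open Scope order_scope.
Local Open Scope classical_set_scope.

(** * Directed sets and Scott open sets *)

Section ScottOpen.
Context {d : Order.disp_t} {P : porderType d}.

Lemma scott_openP (U : set P) : scott_open U <->
  (forall x y, U x -> x <= y -> U y) /\
  (forall D s, directed D -> isLub D s -> U s -> exists2 x, D x & U x).
Proof.
split=> [[lU cU]|[uU sU]]; split.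
- by move=> x y Ux xy; apply: contrapT => nUy; exact: (lU _ _ nUy xy).
- move=> D s dD Ds Us; apply: contrapT => nDU.
  by apply: (cU D s _ dD Ds) => // x Dx Ux; apply: nDU; exists x.
- by move=> x y nUy xy Ux; apply: nUy; exact: uU xy.
- by move=> D s DU dD Ds /(sU D s dD Ds)[x /DU].
Qed.

Lemma scott_closed_le (x : P) : scott_closed [set y | y <= x].
Proof.
split=> [y z zx yz|D s Dx _ [_ lubs]]; first exact: le_trans zx.
exact: lubs.
Qed.

Lemma directed_image d' (Q : porderType d') (f : P -> Q) (D : set P) :
  {homo f : x y / x <= y} -> directed D -> directed (f @` D).
Proof.
move=> fle [[x Dx] dD]; split=> [|_ _ [y Dy <-] [z Dz <-]].
  by exists (f x), x.
have [t [Dt yt zt]] := dD _ _ Dy Dz.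
by exists (f t); split; [exists t|exact: fle|exact: fle].
Qed.

(** An upper bound [b] of the [i]-th projection, put in place of [s i], gives
an upper bound of [D]. *)
Lemma isLub_proj (I : eqType) (D : set (I -> P)) (s : I -> P) (i : I) :
  isLub D s -> isLub [set f i | f in D] (s i).
Proof.
move=> [ubs lubs]; split=> [_ [f Df <-]|b ubb]; first exact/lefP/ubs.
have /lefP/(_ i) : s <= (fun j => if j == i then b else s j).
  apply: lubs => f Df; apply/lefP => j.
  by case: eqP => [->|_]; [apply: ubb; exists f|exact/lefP/ubs].
by rewrite eqxx.
Qed.

End ScottOpen.

(** * Finitely generated closed sets *)

Definition closed_set {d : Order.disp_t} {P : porderType d} (A : set P)
    (cA : scott_closed A) : Gamma P :=
  exist (fun B : set P => `[< scott_closed B >]) A (asboolT cA).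

Section FinDown.
Context {d : Order.disp_t} {P : porderType d}.

Lemma scott_closed_down n (x : 'I_n -> P) :
  scott_closed [set y | exists i, y <= x i].
Proof.
(* The complement is a finite intersection of complements of principal ideals. *)
rewrite -[X in scott_closed X]setCK.
suff: @open (scott P) (~` [set y | exists i, y <= x i]) by [].
rewrite openE => y nxy; rewrite /interior.
have: \forall z \near (y : scott P), forall i, ~ (z <= x i).
  apply: (@filter_forall _ _ _ _ (nbhs_filter (y : scott P))) => i.
  suff: open_nbhs (y : scott P) (~` [set z : P | z <= x i]).
    exact: open_nbhs_nbhs.
  split; last by move=> yx; apply: nxy; exists i.
  suff: scott_open (~` [set z : P | z <= x i]) by [].
  by rewrite /scott_open setCK; exact: scott_closed_le.
by apply: filterS => z nz [i]; exact: nz.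
Qed.

Definition fin_down n (x : 'I_n -> P) : Gamma P :=
  closed_set (scott_closed_down x).

Lemma fin_down_le n (x : 'I_n -> P) (A : Gamma P) :
  (forall i, val A (x i)) <-> fin_down x <= A.
Proof.
have [lA _] := asboolW (valP A).
split=> [Ax|/subsetPset xA i].
  by apply/subsetPset => y [i yx]; exact: lA yx.
by apply: xA; exists i.
Qed.

(** [A] is the supremum of the closed sets generated by tuples of its points:
concatenation of tuples makes this family directed, the empty tuple keeps it
nonempty when [A] is empty, and the one-point tuples exhaust [A]. *)
Lemma scott_open_Gamma_fin (UU : set (Gamma P)) (A : Gamma P) :
  scott_open UU -> UU A ->
  exists n, exists2 x : 'I_n -> P, forall i, val A (x i) & UU (fin_down x).
Proof.
move=> /scott_openP[_ sU] UA.
pose D := [set B | exists n, exists2 x : 'I_n -> P,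
  forall i, val A (x i) & B = fin_down x].
suff [dD lubD] : directed D /\ isLub D A.
  by have [_ [n [x Ax ->]] Ux] := sU D A dD lubD UA; exists n, x.
split.
- split=> [|_ _ [m [x Ax ->]] [n [y Ay ->]]].
    have x0 (i : 'I_0) : P by case: i.
    by exists (fin_down x0), 0, x0 => //; case.
  pose z k := match @fintype.split m n k with inl i => x i | inr j => y j end.
  have zl i : z (lshift n i) = x i by rewrite /z (unsplitK (inl i)).
  have zr j : z (rshift m j) = y j by rewrite /z (unsplitK (inr j)).
  exists (fin_down z); split.
  + exists (m + n)%N, z => // k.
    by rewrite /z; case: fintype.split => ?; [exact: Ax|exact: Ay].
  + apply/fin_down_le => i; rewrite -zl.
    exact: (fin_down_le z (fin_down z)).2.
  + apply/fin_down_le => j; rewrite -zr.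
    exact: (fin_down_le z (fin_down z)).2.
- split=> [_ [n [x Ax ->]]|B ubB]; first exact/fin_down_le.
  apply/subsetPset => a Aa.
  apply: (fin_down_le (fun _ : 'I_1 => a) B).2 ord0.
  by apply: ubB; exists 1, (fun=> a).
Qed.

(** The map [fin_down] preserves directed suprema: a closed set containing all
the tuples of a directed [D] contains every projection of [D], which is
directed, hence also the coordinates of the supremum of [D]. *)
Lemma scott_open_fin_down n (UU : set (Gamma P)) :
  scott_open UU -> scott_open [set x : 'I_n -> P | UU (fin_down x)].
Proof.
move=> /scott_openP[uU sU].
have dle : {homo (@fin_down n) : x y / x <= y}.
  by move=> x y /lefP xy; apply/subsetPset => z [i zx]; exists i;
    exact: le_trans (xy i).
apply/scott_openP; split=> [x y Ux /dle|D s dD Ds Us]; first exact: uU.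
suff lubD : isLub (@fin_down n @` D) (fin_down s).
  have [_ [x Dx <-] Ux] := sU _ _ (directed_image dle dD) lubD Us.
  by exists x.
split=> [_ [x Dx <-]|B ubB]; first by apply: dle; case: Ds => + _; exact.
apply/fin_down_le => i.
have [_ cB] := asboolW (valP B).
apply: cB (isLub_proj i Ds) => [_ [x Dx <-]|].
  by apply: (fin_down_le x B).2; apply: ubB; exists x.
by apply: directed_image dD => x y /lefP.
Qed.

End FinDown.

(** * Neighbourhoods in a product and in the lower Vietoris topology *)

(** The filter generated by the boxes around [x] converges to [x] in each
coordinate, hence converges to [x]. *)
Lemma ptws_open_box (I : eqType) (T : topologicalType) (W : set {ptws I -> T})
    (x : I -> T) :
  open W -> W x ->
  exists2 U : I -> set T, forall i, open_nbhs (x i) (U i) &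
    forall y : I -> T, (forall i, U i (y i)) -> W y.
Proof.
move=> oW Wx.
pose F : set_system {ptws I -> T} :=
  filter_from [set U : I -> set T | forall i, open_nbhs (x i) (U i)]
    (fun U => [set y | forall i, U i (y i)]).
have FF : Filter F.
  apply: filter_from_filter => [|U V xU xV].
    by exists (fun=> setT) => i; split=> //; exact: openT.
  exists (fun i => U i `&` V i) => [i|y UVy]; first exact: open_nbhsI.
  by split=> i; have [] := UVy i.
suff cvgF : F --> (x : {ptws I -> T}).
  suff: F W by move=> [U xU UW]; exists U.
  by apply: cvgF; exact: open_nbhs_nbhs.
apply/cvg_sup => i V [_ [[B oB <-] Bx] BV].
exists (fun j => if j == i then B else setT) => [j|y By].
  by case: eqP => [->|_]; split=> //; exact: openT.
by apply: BV; have := By i; rewrite eqxx.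
Qed.

Section LowerVietoris.
Context {d : Order.disp_t} {P : porderType d}.

Lemma scott_open_diamond (U : set P) :
  scott_open U -> scott_open (@diamond d P U).
Proof.
move=> cU; pose C := closed_set cU.
suff -> : diamond U = ~` [set A | A <= C].
  by rewrite /scott_open setCK; exact: scott_closed_le.
apply/seteqP; split=> A.
  by move=> [a [Aa Ua]] /subsetPset/(_ _ Aa).
move=> nAC; apply: contrapT => AU; apply: nAC; apply/subsetPset => a Aa Ua.
by apply: AU; exists a.
Qed.

Lemma open_diamond (U : set P) :
  scott_open U -> lower_vietoris_topology P (diamond U).
Proof.
move=> oU; exists [set diamond U]; last by rewrite bigcup_set1.
by move=> _ ->; exact: (@finI_from1 (set P)).
Qed.

Lemma lower_vietoris_sub_scott :
  lower_vietoris_topology P `<=` scott_topology (Gamma P).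
Proof.
move=> _ [B sB <-].
suff: @open (scott (Gamma P)) (\bigcup_(C in B) C) by [].
apply: bigcup_open => C /sB[D sD <-].
rewrite openE => A CA; rewrite /interior; apply: filter_bigI => U DU.
apply: open_nbhs_nbhs; split; last exact: CA.
by apply: scott_open_diamond; have /sD := DU; rewrite inE.
Qed.

End LowerVietoris.

Theorem proposition3p5 (d : Order.disp_t) (P : porderType d) :
  (forall n : nat,
     scott_topology ('I_n -> P) = scott_product_topology n P) ->
  scott_topology (Gamma P) = lower_vietoris_topology P.
Proof.
move=> prodP; apply/seteqP; split; last exact: lower_vietoris_sub_scott.
move=> UU oU.
suff: @open (lower_vietoris P) UU by [].
rewrite openE => A UA; rewrite /interior.
have [n [x Ax Ux]] := scott_open_Gamma_fin oU UA.
have : scott_topology ('I_n -> P) [set x | UU (fin_down x)].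
  exact: scott_open_fin_down.
rewrite prodP => /(@ptws_open_box _ (scott P))/(_ Ux)[U nU boxU].
have Afilter := nbhs_filter (A : lower_vietoris P).
have : \forall B \near (A : lower_vietoris P), forall i, diamond (U i) B.
  apply: (@filter_forall _ _ _ _ Afilter) => i.
  have [oUi Uxi] := nU i.
  apply: (@open_nbhs_nbhs (lower_vietoris P)); split.
    exact: open_diamond.
  by exists (x i).
apply: (@filterS _ _ Afilter) => B meetB.
have [y By] : exists y : 'I_n -> P, forall i, val B (y i) /\ U i (y i).
  by case: (choice meetB) => y By; exists y.
have [uU _] := (scott_openP UU).1 oU.
apply: (uU (fin_down y)).
  by apply: boxU => i; have [] := By i.
by apply/fin_down_le => i; have [] := By i.
Qed.
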